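(* Let $H$ be a self-adjoint operator on the Hilbert space $\mathcal{H}$. Then: 1) Any $\Psi$ in the domain of $|H|^{1/2}$ also belongs to the domain of $[\exp_\phi(H-\beta)]^{1/2}$ for any real number $\beta$. 2) The map $\beta\mapsto \exp_\phi(H-\beta)$, $\beta\in\mathbb{R}$, is strongly continuous. 3) The map $\beta\mapsto \|[\exp_\phi(H-\beta)]^{1/2}\Psi\|$ is strictly decreasing on $\mathbb{R}$ for any $\Psi\neq 0$ in the domain of $H$. If moreover $\Omega\in\mathcal{H}$ is normalized ($\|\Omega\|=1$), $\Omega$ belongs to the domain of $|H|^{1/2}$, and the expectation $\langle H\rangle_\omega$ vanishes, then: 4) The map $\beta\mapsto \|[\exp_\phi(H-\beta)]^{1/2}\Omega\|$ is a one-to-one map from $(-\infty,+\infty)$ onto $(0,+\infty)$. 5) There exists a unique non-negative number, denoted $\alpha(H)$, for which $\|[\exp_\phi(H-\alpha(H))]^{1/2}\Omega\|=1$. 6) For any real number $c$ one has $\alpha(H+c)=\alpha(H)+c$.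
   Context: The function $\log_\phi:(0,+\infty)\to\mathbb{R}$ is $\log_\phi(v)=v-1+\log v$; it is a strictly increasing bijection, and $\exp_\phi:\mathbb{R}\to(0,+\infty)$ denotes its inverse. Functions of self-adjoint operators are defined by the spectral theorem (possibly unbounded operators); $H-\beta$ means $H-\beta\mathbb{I}$. For a unit vector $\Omega$, $\omega$ denotes the vector state defined by $\Omega$. If $H=\int\lambda\,\mathrm{d}E_\lambda$ is the spectral decomposition of the self-adjoint operator $H$, the $\omega$-expectation of $H$ is $\langle H\rangle_\omega=\int_{-\infty}^{\infty}\lambda\,\mathrm{d}(E_\lambda\Omega,\Omega)$, provided the integral converges absolutely; this is the case when $\Omega$ belongs to the domain of $|H|^{1/2}$. Strong continuity in item 2: the domain of $\exp_\phi(H-\beta)$ does not depend on $\beta$, and for each vector $\psi$ in this common domain the map $\beta\mapsto\exp_\phi(H-\beta)\psi$ is norm continuous. In item 6, $\alpha(H+c)$ denotes the unique real number $\beta$ (not required to be non-negative) for which $\|[\exp_\phi(H+c-\beta)]^{1/2}\Omega\|=1$. *)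

(* Defs.v *)
From HB Require Import structures.
From mathcomp Require Import all_boot all_order all_algebra.
From mathcomp Require Import complex.
From mathcomp Require Import all_classical all_reals all_analysis.

Set Implicit Arguments.
Unset Strict Implicit.
Unset Printing Implicit Defensive.

Import Order.TTheory GRing.Theory Num.Theory.
Import numFieldNormedType.Exports.
Import HBSimple.

Local Open Scope classical_set_scope.
Local Open Scope ring_scope.
Local Open Scope complex_scope.

Section deformed_exponential.
Variable R : realType.

Definition logphi (v : R) : R := v - 1 + ln v.

Definition expphi (u : R) : R := xget 1 [set v | 0 < v /\ logphi v = u].

End deformed_exponential.

(* A complex Hilbert space is a complete normed module V over R[i] together
   with a form ip : {dot V for Num.conj} such that `|x| ^+ 2 = ip x x.  The form
   ip is linear in its first argument.  The norm of V takes its values in R[i];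
   hnorm is the same norm with values in R. *)
Definition hnorm (R : realType) (V : normedModType R[i]) (x : V) : R :=
  complex.Re `|x|.

Section unbounded_operators.
Variables (R : realType) (V : completeNormedModType R[i]).
Variable ip : {dot V for Num.conj}.

(* The values outside of the domain are irrelevant. *)
Record operator := Operator { odom : set V ; oapp :> V -> V }.

Definition op_eq (S T : operator) :=
  odom S = odom T /\ forall x, odom T x -> S x = T x.

Definition linear_operator (T : operator) :=
  odom T 0 /\
  forall (a : R[i]) x y, odom T x -> odom T y ->
    odom T (a *: x + y) /\ T (a *: x + y) = a *: T x + T y.

Definition adjoint (T : operator) : operator :=
  let spec y z := forall x, odom T x -> ip (T x) y = ip x z in
  Operator [set y | exists z, spec y z] (fun y => xget 0 (spec y)).

Definition self_adjoint (T : operator) :=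
  [/\ linear_operator T, dense (odom T) & op_eq (adjoint T) T].

Definition op_shift (T : operator) (c : R) : operator :=
  Operator (odom T) (fun x => T x + c%:C *: x).

End unbounded_operators.

Section spectral_calculus.
Variables (R : realType) (V : completeNormedModType R[i]).
Variable ip : {dot V for Num.conj}.

(* A projection-valued measure on the Borel sets of R.  As for the measures of
   the library, the values at non-measurable sets carry no information; they
   are required to be orthogonal projections too (e.g. 0) so that the
   measures pvm_measure below are nonnegative at every set. *)
Record pvm := Pvm {
  pvm_fun :> set (measurableTypeR R) -> V -> V ;
  pvm_linear : forall B, linear (pvm_fun B) ;
  pvm_idem : forall B x, pvm_fun B (pvm_fun B x) = pvm_fun B x ;
  pvm_sym : forall B x y, ip (pvm_fun B x) y = ip x (pvm_fun B y) ;
  pvm0 : forall x, pvm_fun set0 x = 0 ;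
  pvmT : forall x, pvm_fun setT x = x ;
  pvmI : forall A B, measurable A -> measurable B ->
    forall x, pvm_fun (A `&` B) x = pvm_fun A (pvm_fun B x) ;
  pvm_sigma_additive : forall F : nat -> set (measurableTypeR R),
    (forall n, measurable (F n)) -> trivIset setT F ->
    forall x, (fun n => \sum_(i < n) pvm_fun (F i) x) @ \oo
                --> pvm_fun (\bigcup_n F n) x }.

Variable E : pvm.

Definition pvm_measure (psi : V) (B : set (measurableTypeR R)) : \bar R :=
  (complex.Re (ip (E B psi) psi))%:E.

(* The spectral integral \int s dE of a simple function, at psi. *)
Definition simple_pvm_integral (s : {sfun measurableTypeR R >-> R}) (psi : V) :
    V :=
  \sum_(x \in range s) x%:C *: E (s @^-1` [set x]) psi.

(* chi = (\int f dE) psi: chi is the limit of the integrals of simple functions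
   that converge to f in the L^2 space of the measure (E(.) psi, psi). *)
Definition is_pvm_integral (f : R -> R) (psi chi : V) :=
  exists2 s : nat -> {sfun measurableTypeR R >-> R},
    (fun n => \int[pvm_measure psi]_x ((s n x - f x) ^+ 2)%:E)%E @ \oo
      --> 0%E &
    (fun n => simple_pvm_integral (s n) psi) @ \oo --> chi.

(* The operator \int f dE, that is, f(H) when E is the spectral measure of H. *)
Definition fcalc (f : R -> R) : operator V :=
  Operator [set psi | (\int[pvm_measure psi]_x (f x ^+ 2)%:E < +oo)%E]
           (fun psi => xget 0 (is_pvm_integral f psi)).

Definition spectral_resolution (T : operator V) := op_eq T (fcalc id).

Definition vector_mean (Omega : V) : \bar R :=
  (\int[pvm_measure Omega]_x x%:E)%E.

End spectral_calculus.

Section functions_of_H.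
Variables (R : realType) (V : completeNormedModType R[i]).
Variables (ip : {dot V for Num.conj}) (E : pvm ip).

(* With E the spectral measure of H: |H|^{1/2}, exp_phi(H - beta) and
   [exp_phi(H - beta)]^{1/2}. *)
Definition sqrt_abs_op : operator V := fcalc E (fun l => Num.sqrt `|l|).

Definition expphi_op (beta : R) : operator V :=
  fcalc E (fun l => expphi (l - beta)).

Definition sqrt_expphi_op (beta : R) : operator V :=
  fcalc E (fun l => Num.sqrt (expphi (l - beta))).

End functions_of_H.

(* Main.v *)
Require Import Defs.
From HB Require Import structures.
From mathcomp Require Import all_boot all_order all_algebra finmap.
From mathcomp Require Import complex.
From mathcomp Require Import all_classical all_reals all_analysis.
From mathcomp Require Import measurable_realfun ring lra.

Set Implicit Arguments.
Unset Strict Implicit.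
Unset Printing Implicit Defensive.

Import Order.TTheory GRing.Theory Num.Theory.
Import numFieldNormedType.Exports.
Import HBSimple.

Local Open Scope classical_set_scope.
Local Open Scope ring_scope.
Local Open Scope complex_scope.

(** Write [mu] for the distribution of [H] in the state [psi], that is the
measure [(E(.) psi, psi)]. The spectral integral is an isometry from [L^2(mu)]
to [V] ([pvm_integral_isometry]), so that [||f(H) psi||^2 = \int f^2 dmu]. In
particular [||[exp_phi(H - beta)]^{1/2} psi||^2 = \int exp_phi(l - beta)
dmu(l)], and all claims but the translation rule [alpha(H + c) = alpha(H) + c]
are statements about this integral.

The function [log_phi] has slope larger than [1], hence [exp_phi] is strictly
increasing and contracts distances. Therefore [exp_phi(l - beta)] is at most
[1 + |beta| + |l|], which is integrable as soon as [psi] is in the domain of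
[|H|^{1/2}]; and the functions [exp_phi(. - beta)] and [exp_phi(. - beta')]
differ by at most [|beta - beta'|], so that they define operators with the
same domain, whose values depend on [beta] in a Lipschitz way. Integrating the
strict monotonicity of [exp_phi] against the nonzero measure [mu] shows that
the norm is strictly decreasing in [beta].

The concavity bound [log v <= v - 1] means [exp_phi(u) >= 1 + u / 2]; for a
unit vector [Omega] of mean [0] it integrates to [||[exp_phi(H - beta)]^{1/2}
Omega||^2 >= 1 - beta/2]. So the norm is unbounded as [beta] tends to minus
infinity, and at least [1] at [beta = 0], which places the solution [alpha(H)]
on the nonnegative side. As [beta] tends to plus infinity the norm tends to
[0] by dominated convergence, and the intermediate value theorem makes it a
bijection onto the positive half-line.

The translation rule compares [mu] with the distribution [mu'] given by any
spectral resolution [F] of [H + c], and asks for the uniqueness of spectral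
measures. It is obtained without resolvents: the range of the spectral
projection of [[a - r, a + r]] is determined by the operator, being the set of
vectors for which [||(H - a)^n psi||] grows at most like [r^n]
([concentration_transfer]). Hence [F] of [[a + c - r, a + c + r]] and [E] of
[[a - r, a + r]] have the same range, and [mu'] is the translate of [mu] since
the closed intervals generate the Borel sets ([spectral_measure_shift]). *)

(** * The deformed exponential *)

Section expphi_lemmas.
Variable R : realType.
Implicit Types u v : R.

Lemma logphi_increase v w : 0 < v -> v < w -> w - v < logphi w - logphi v.
Proof.
move=> v0 vw; have w0 := lt_trans v0 vw.
have : ln v < ln w by rewrite ltr_ln.
rewrite /logphi; lra.
Qed.

Lemma continuous_logphi v : 0 < v -> {for v, continuous (@logphi R)}.
Proof.
move=> v0; rewrite /logphi; apply: cvgD; last exact: continuous_ln.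
by apply: cvgB; [exact: cvg_id|exact: cvg_cst].
Qed.

Lemma logphi_surjective u : exists v, 0 < v /\ logphi v = u.
Proof.
have on_segment a b : 0 < a -> a <= b -> logphi a <= u -> u <= logphi b ->
    exists v, 0 < v /\ logphi v = u.
  move=> a0 ab ua ub.
  have cf : {within `[a, b], continuous (@logphi R)}.
    apply: continuous_in_subspaceT => x; rewrite inE/= in_itv/= => /andP[ax _].
    exact/continuous_logphi/(lt_le_trans a0).
  have [|c + <-] := IVT ab cf (v := u).
    by rewrite ge_min le_max ua ub orbT.
  rewrite in_itv/= => /andP[ac _]; exists c; split => //.
  exact: lt_le_trans ac.
(* [u] is bracketed by the values at [1] and [1 + u] when it is nonnegative,
   at [exp u] and [1] otherwise. *)
have [u0|u0] := leP 0 u.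
  apply: (on_segment 1 (1 + u)); rewrite ?ltr01 ?lerDl ?/logphi ?ln1 //;
    first lra.
  have : 0 <= ln (1 + u) by rewrite ln_ge0 // lerDl.
  by rewrite /logphi; lra.
have e1 : expR u <= 1 by rewrite -expR0 ler_expR ltW.
apply: (on_segment (expR u) 1); rewrite ?expR_gt0 // /logphi ?expRK ?ln1; lra.
Qed.

Lemma expphi_spec u : 0 < expphi u /\ logphi (expphi u) = u.
Proof. exact: (xgetPex 1 (logphi_surjective u)). Qed.

Lemma expphi_gt0 u : 0 < expphi u. Proof. by have [] := expphi_spec u. Qed.

Lemma expphiK : cancel (@expphi R) (@logphi R).
Proof. by move=> u; have [] := expphi_spec u. Qed.

Lemma ltr_expphi u v : u < v -> expphi u < expphi v.
Proof.
move=> uv; rewrite ltNge; apply/negP; rewrite le_eqVlt => /predU1P[e|].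
  by move: uv; rewrite -(expphiK u) -(expphiK v) e ltxx.
by move=> vu; have := logphi_increase (expphi_gt0 _) vu; rewrite !expphiK; lra.
Qed.

(** The slope of [logphi] is at least [1], so its inverse contracts
distances. *)
Lemma expphi_lipschitz u v : `|expphi u - expphi v| <= `|u - v|.
Proof.
wlog uv : u v / u < v => [H|].
  have [/H//|/H|->] := ltgtP u v; last by rewrite !subrr.
  by rewrite distrC [leRHS]distrC.
have euv := ltr_expphi uv; have := logphi_increase (expphi_gt0 _) euv.
rewrite !expphiK distrC [leRHS]distrC !ger0_norm; lra.
Qed.

Lemma expphi0 : expphi 0 = 1 :> R.
Proof.
have e := expphiK (0 : R); have [h|h|//] := ltgtP (expphi 0) (1 : R).
  by have := logphi_increase (expphi_gt0 _) h; rewrite e /logphi ln1; lra.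
by have := logphi_increase ltr01 h; rewrite e /logphi ln1; lra.
Qed.

Lemma expphi_le u : expphi u <= 1 + `|u|.
Proof.
have := expphi_lipschitz u 0; rewrite expphi0 subr0.
by move=> /(le_trans (ler_norm _)); lra.
Qed.

(** This is [ln v <= v - 1] read at [v = expphi u]. An affine lower bound can
be integrated knowing only the mean of [u], which is how the mean of [H] enters
the theorem. *)
Lemma expphi_ge u : 1 + u / 2 <= expphi u.
Proof.
have h0 := expphi_gt0 u.
have : ln (1 + (expphi u - 1)) <= expphi u - 1 by apply: le_ln1Dx; lra.
by rewrite addrCA subrr addr0; have := expphiK u; rewrite /logphi; lra.
Qed.

(** Dropping [v > 0] from [v - 1 + ln v = u] leaves [ln v <= u + 1]; this is the
decay of [expphi] at minus infinity. *)
Lemma expphi_le_expR u : expphi u <= expR (u + 1).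
Proof.
have h0 := expphi_gt0 u.
rewrite -[leLHS]lnK ?posrE // ler_expR.
by have := expphiK u; rewrite /logphi; lra.
Qed.

Lemma continuous_expphi : continuous (@expphi R).
Proof.
move=> u; apply/cvgrPdist_le => e e0; near=> v.
apply: le_trans (expphi_lipschitz _ _) _.
by near: v; apply: cvgr_dist_le.
Unshelve. all: by end_near. Qed.

Lemma measurable_expphi_shift b :
  measurable_fun setT (fun l : measurableTypeR R => expphi (l - b)).
Proof.
apply: (measurableT_comp (f := @expphi R)).
  exact: continuous_measurable_fun continuous_expphi.
exact: measurable_funB.
Qed.

End expphi_lemmas.

(** * Norm and inner product of a complex Hilbert space *)

Section hilbert.
Variables (R : realType) (V : completeNormedModType R[i]).
Variable ip : {dot V for Num.conj}.
Hypothesis ip_norm : forall x : V, `|x| ^+ 2 = ip x x.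
Implicit Types x y : V.

Definition rip x y : R := complex.Re (ip x y).

Lemma norm_hnorm x : `|x| = (hnorm x)%:C.
Proof. by rewrite /hnorm RRe_real // normr_real. Qed.

Lemma hnorm_ge0 x : 0 <= hnorm x.
Proof. by rewrite -lecR -norm_hnorm; exact: normr_ge0. Qed.

Lemma hnorm_eq0 x : (hnorm x == 0) = (x == 0).
Proof. by rewrite -(inj_eq (@complexI R)) -norm_hnorm normr_eq0. Qed.

Lemma hnormBC x y : hnorm (x - y) = hnorm (y - x).
Proof. by rewrite /hnorm distrC. Qed.

Lemma hnorm_triangle x y : hnorm (x + y) <= hnorm x + hnorm y.
Proof. by rewrite -lecR (raddfD (real_complex R))/= -!norm_hnorm ler_normD. Qed.

Lemma hnorm_sqr x : hnorm x ^+ 2 = rip x x.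
Proof. by rewrite /rip -ip_norm norm_hnorm -rmorphXn. Qed.

Lemma ripC x y : rip x y = rip y x.
Proof. by rewrite /rip hermC/= expr0 mul1r; case: (ip y x). Qed.

Lemma ripBl x x' y : rip (x - x') y = rip x y - rip x' y.
Proof. by rewrite /rip linearBl raddfB. Qed.

Lemma ripBr x y y' : rip x (y - y') = rip x y - rip x y'.
Proof. by rewrite ripC ripBl !(ripC x). Qed.

Lemma ripZl (a : R) x y : rip (a%:C *: x) y = a * rip x y.
Proof. by rewrite /rip linearZl_LR/=; case: (ip x y) => r i /=;
  rewrite mul0r subr0. Qed.

Lemma rip_suml (I : Type) (s : seq I) (P : pred I) (F : I -> V) y :
  rip (\sum_(i <- s | P i) F i) y = \sum_(i <- s | P i) rip (F i) y.
Proof. by rewrite /rip linear_sumlz raddf_sum. Qed.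

Lemma hnormB_sqr x y :
  hnorm (x - y) ^+ 2 = hnorm x ^+ 2 + hnorm y ^+ 2 - 2 * rip x y.
Proof. by rewrite !hnorm_sqr ripBl !ripBr (ripC y x); lra. Qed.

(** The topology of [V] is defined with complex radii; a complex number is
positive only if it is real, so real radii suffice. *)
Lemma cvg_hnormP (T : Type) (F : set_system T) {FF : Filter F} (u : T -> V) l :
  u @ F --> l <-> hnorm (l - u t) @[t --> F] --> (0 : R).
Proof.
split=> [/cvgrPdist_lt ul|/cvgrPdist_lt ul].
  apply/cvgrPdist_lt => e e0.
  have e0' : 0 < e%:C by rewrite ltcR.
  have := ul _ e0'; apply: filterS => t.
  by rewrite norm_hnorm ltcR sub0r normrN ger0_norm // hnorm_ge0.
apply/cvgrPdist_lt => -[a b]; rewrite ltcE/= => /andP[/eqP -> a0].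
have := ul _ a0; apply: filterS => t.
by rewrite sub0r normrN ger0_norm ?hnorm_ge0 // norm_hnorm; rewrite -ltcR.
Qed.

Lemma cvg_hnorm (T : Type) (F : set_system T) {FF : Filter F} (u : T -> V) l :
  u @ F --> l -> hnorm (u t) @[t --> F] --> hnorm l.
Proof.
move=> /cvg_hnormP/cvgrPdist_lt ul; apply/cvgrPdist_lt => e /ul;
  apply: filterS => t.
rewrite sub0r normrN ger0_norm ?hnorm_ge0 //; apply: le_lt_trans.
have := hnorm_triangle (l - u t) (u t); have := hnorm_triangle (u t - l) l.
rewrite !subrK hnormBC ler_norml; lra.
Qed.

(** Polarization reduces the continuity of the inner product to that of the
norm. *)
Lemma cvg_rip (T : Type) (F : set_system T) {FF : Filter F} (u : T -> V) l y :
  u @ F --> l -> rip (u t) y @[t --> F] --> rip l y.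
Proof.
move=> ul.
have e x : rip x y = 2^-1 * (hnorm x ^+ 2 + hnorm y ^+ 2 - hnorm (x - y) ^+ 2).
  by rewrite hnormB_sqr; lra.
rewrite e; under eq_fun do rewrite e.
apply: cvgM; first exact: cvg_cst.
apply: cvgB; first apply: cvgD; [|exact: cvg_cst|].
  by rewrite expr2; under eq_fun do rewrite expr2; apply: cvgM;
    exact: cvg_hnorm.
have h : hnorm (u t - y) @[t --> F] --> hnorm (l - y).
  by apply: cvg_hnorm; apply: cvgB => //; exact: cvg_cst.
by rewrite expr2; under eq_fun do rewrite expr2; exact: cvgM.
Qed.

(** The bound [d m + d n] is the one that comes out of comparing two terms of a
sequence with their common limit in mean square. *)
Lemma cauchy_hnorm (u : nat -> V) (d : nat -> R) :
  d @ \oo --> (0 : R) -> (forall m n, hnorm (u m - u n) ^+ 2 <= d m + d n) ->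
  cvg (u @ \oo).
Proof.
move=> d0 ud; apply/cauchy_cvgP/cauchyP => -[a b];
  rewrite ltcE/= => /andP[/eqP -> a0].
have [N _ HN] : \forall n \near \oo, `|0 - d n| < a ^+ 2 / 2.
  by move/cvgrPdist_lt : d0; apply; rewrite divr_gt0 // exprn_gt0.
exists (u N); exists N => // n /= Nn; rewrite -ball_normE/= norm_hnorm.
suff : hnorm (u N - u n) < a by rewrite -ltcR.
rewrite -(@ltr_pXn2r _ 2) // ?nnegrE ?hnorm_ge0 ?ltW //.
apply: le_lt_trans (ud _ _) _.
have := HN N (leqnn _); have := HN n Nn; rewrite /= !sub0r !normrN.
by have := ler_norm (d N); have := ler_norm (d n); lra.
Qed.

End hilbert.

(** * Convergence in mean square *)

Section square_integrals.
Context d (T : measurableType d) (R : realType).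
Variable mu : {measure set T -> \bar R}.
Implicit Types f g h : T -> R.

Definition sqint f : \bar R := (\int[mu]_x (f x ^+ 2)%:E)%E.

Lemma sqint_ge0 f : (0 <= sqint f)%E.
Proof. by apply: integral_ge0 => x _; rewrite lee_fin sqr_ge0. Qed.

Lemma measurable_sqr f : measurable_fun setT f ->
  measurable_fun setT (fun x => (f x ^+ 2)%:E).
Proof. by move=> mf; apply/measurable_EFinP; exact: measurable_funX. Qed.

(** Weighted inequalities between squares, integrated term by term, are the only
form of the triangle inequality of [L^2] that the proof needs; they hold for
infinite integrals as well. *)
Lemma le_sqint f g h (a b : R) : 0 <= a -> 0 <= b ->
  measurable_fun setT f -> measurable_fun setT g -> measurable_fun setT h ->
  (forall x, f x ^+ 2 <= a * g x ^+ 2 + b * h x ^+ 2) ->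
  (sqint f <= a%:E * sqint g + b%:E * sqint h)%E.
Proof.
move=> a0 b0 mf mg mh fgh.
have sq0 (k : T -> R) x : (0 <= (k x ^+ 2)%:E)%E by rewrite lee_fin sqr_ge0.
rewrite /sqint -!ge0_integralZl_EFin //; try by move=> *; exact: sq0.
- rewrite -ge0_integralD //; try by move=> x _; rewrite mule_ge0.
  + apply: ge0_le_integral => //; try by move=> x _;
      rewrite ?adde_ge0 ?mule_ge0.
    * exact: measurable_sqr.
    * by apply: emeasurable_funD; apply: emeasurable_funM => //;
      exact: measurable_sqr.
    * by move=> x _; rewrite -!EFinM -EFinD lee_fin.
  + by apply: emeasurable_funM => //; exact: measurable_sqr.
  + by apply: emeasurable_funM => //; exact: measurable_sqr.
- exact: measurable_sqr.
- exact: measurable_sqr.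
Qed.

Lemma le_sqint1 f g : measurable_fun setT f -> measurable_fun setT g ->
  (forall x, f x ^+ 2 <= g x ^+ 2) -> (sqint f <= sqint g)%E.
Proof.
move=> mf mg fg; have := @le_sqint f g g 1 0 ler01 (lexx 0) mf mg mg.
by rewrite mul1e mul0e adde0; apply => x; rewrite mul1r mul0r addr0.
Qed.

(** Young's inequality [u^2 <= (1+e) h^2 + (1+1/e) (u-h)^2] stands in for
Minkowski's: letting first [n] grow and then [e] shrink transports the norm
to the limit. *)
Lemma sqint_cvg (u : nat -> T -> R) h (a : nat -> R) (A : R) :
  (forall n, measurable_fun setT (u n)) -> measurable_fun setT h ->
  (fun n => sqint (fun x => u n x - h x)) @ \oo --> 0%E ->
  (forall n, sqint (u n) = (a n)%:E) -> a @ \oo --> A ->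
  sqint h = A%:E.
Proof.
move=> mu_ mh d0 ua aA.
have md n : measurable_fun setT (fun x => u n x - h x).
  exact: measurable_funB.
have young (e p q : R) : 0 < e ->
  p ^+ 2 <= (1 + e) * q ^+ 2 + (1 + e^-1) * (p - q) ^+ 2.
  move=> e0; rewrite -subr_ge0.
  have -> : (1 + e) * q ^+ 2 + (1 + e^-1) * (p - q) ^+ 2 - p ^+ 2 =
    (e * q - (p - q)) ^+ 2 / e by field; rewrite gt_eqF.
  by rewrite divr_ge0 ?sqr_ge0 // ltW.
have d0e (e : R) : ((1 + e^-1)%:E * sqint (fun x =>
  (u n x - h x)%R))%E @[n --> \oo] --> 0%E.
  by rewrite -(mule0 (1 + e^-1)%:E); apply: cvgeZl.
have aAE : (a n)%:E @[n --> \oo] --> A%:E by apply/cvg_EFin => //; exact: nearW.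
have up (e : R) : 0 < e -> (sqint h <= (1 + e)%:E * A%:E)%E.
  move=> e0; have e0' : 0 <= e^-1 by rewrite invr_ge0 ltW.
  have lim : ((1 + e)%:E * (a n)%:E + (1 + e^-1)%:E * sqint (fun x =>
    (u n x - h x)%R))%E
      @[n --> \oo] --> ((1 + e)%:E * A%:E + 0)%E.
    by apply: cvgeD; [by rewrite fin_num_adde_defl|exact: cvgeZl|exact: d0e].
  rewrite adde0 in lim; apply: (cvge_to_ge lim); apply: nearW => n.
  rewrite -ua; apply: le_sqint => //; try lra.
  by move=> x; have := young e (h x) (u n x) e0;
    rewrite -(sqrrN (h x - u n x)) opprB.
have low (e : R) : 0 < e -> (A%:E <= (1 + e)%:E * sqint h)%E.
  move=> e0; have e0' : 0 <= e^-1 by rewrite invr_ge0 ltW.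
  have lim : ((1 + e)%:E * sqint h + (1 + e^-1)%:E * sqint (fun x =>
    (u n x - h x)%R))%E
      @[n --> \oo] --> ((1 + e)%:E * sqint h + 0)%E.
    by apply: cvgeD; [by rewrite fin_num_adde_defl|exact: cvg_cst|exact: d0e].
  rewrite adde0 in lim; apply: (lee_cvg_to aAE lim); apply: nearW => n.
  rewrite -ua; apply: le_sqint => //; try lra.
  by move=> x; exact: young.
have := up _ ltr01; have := sqint_ge0 h; move: up low;
  case: (sqint h) => // r up low.
  rewrite lee_fin => r0 _; congr EFin; apply/eqP; rewrite eq_le; apply/andP;
    split.
    apply/ler_addgt0Pr => e e0; have A0 : 0 < `|A| + 1 by rewrite ltr_wpDl.
    have := up (e / (`|A| + 1)) (divr_gt0 e0 A0);
      rewrite lee_fin => /le_trans -> //.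
    rewrite mulrDl mul1r lerD2l mulrAC ler_pdivrMr // ler_wpM2l ?(ltW e0) //.
    by rewrite (le_trans (ler_norm _)) // lerDl.
  apply/ler_addgt0Pr => e e0; have A0 : 0 < r + 1 by rewrite ltr_wpDl.
  have := low (e / (r + 1)) (divr_gt0 e0 A0);
    rewrite lee_fin => /le_trans -> //.
  rewrite mulrDl mul1r lerD2l mulrAC ler_pdivrMr // ler_wpM2l ?(ltW e0) //.
  by rewrite lerDl.
Qed.

Lemma sqint_cvgB (u v : nat -> T -> R) f g :
  (forall n, measurable_fun setT (u n)) ->
    (forall n, measurable_fun setT (v n)) ->
  measurable_fun setT f -> measurable_fun setT g ->
  (fun n => sqint (fun x => u n x - f x)) @ \oo --> 0%E ->
  (fun n => sqint (fun x => v n x - g x)) @ \oo --> 0%E ->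
  (fun n => sqint (fun x => (u n x - v n x) - (f x - g x))) @ \oo --> 0%E.
Proof.
move=> mu_ mv mf mg u0 v0.
have lim : (2%:E * sqint (fun x => (u n x - f x)%R) + 2%:E * sqint (fun x =>
  (v n x - g x)%R))%E
   @[n --> \oo] --> 0%E.
  by rewrite -[X in _ --> X]adde0 -(mule0 2%:E); apply: cvgeD => //;
    exact: cvgeZl.
apply: (squeeze_cvge _ (@cvg_cst _ _ _ _ _) lim); apply: nearW => n.
rewrite sqint_ge0/=; apply: le_sqint => //; try exact: measurable_funB.
- by apply: measurable_funB; exact: measurable_funB.
- by move=> x; have := sqr_ge0 ((u n x - f x) + (v n x - g x)); lra.
Qed.

Import HBNNSimple.

(** The positive and negative parts of [f] are approximated from below, so that
the error is at most [|f|] everywhere and dominated convergence applies to its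
square. *)
Lemma sqint_sfun_approx f : measurable_fun setT f -> (sqint f < +oo)%E ->
  exists s : nat -> {sfun T >-> R},
    (fun n => sqint (fun x => s n x - f x)) @ \oo --> 0%E.
Proof.
move=> mf f2.
have mp : measurable_fun setT (EFin \o f^\+) by apply/measurable_EFinP;
  exact: measurable_funrpos.
have mn : measurable_fun setT (EFin \o f^\-) by apply/measurable_EFinP;
  exact: measurable_funrneg.
pose p n : {sfun T >-> R} := nnsfun_approx measurableT mp n.
pose q n : {sfun T >-> R} := nnsfun_approx measurableT mn n.
exists (fun n => p n - q n).
have p0 n x : 0 <= p n x by [].
have q0 n x : 0 <= q n x by [].
have pf n x : p n x <= f^\+ x.
  rewrite /p/= nnsfun_approxE -lee_fin; apply: le_approx => // y _.
  by rewrite lee_fin funrpos_ge0.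
have qf n x : q n x <= f^\- x.
  rewrite /q/= nnsfun_approxE -lee_fin; apply: le_approx => // y _.
  by rewrite lee_fin funrneg_ge0.
have pl x : p n x @[n --> \oo] --> f^\+ x.
  apply: (fine_cvg (cvg_nnsfun_approx measurableT _ _ _)) => // y _.
  by rewrite lee_fin funrpos_ge0.
have ql x : q n x @[n --> \oo] --> f^\- x.
  apply: (fine_cvg (cvg_nnsfun_approx measurableT _ _ _)) => // y _.
  by rewrite lee_fin funrneg_ge0.
have fB x : f x = f^\+ x - f^\- x by rewrite -[in LHS](funrposBneg f).
have fD x : `|f x| = f^\+ x + f^\- x by rewrite -[RHS]/((f^\+ + f^\-) x)
  funrposDneg.
have mpq n : measurable_fun setT (fun x => p n x - q n x - f x).
  by apply: measurable_funB => //; exact: measurable_funB.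
have [|||||_ _] := @dominated_convergence _ _ _ mu _ measurableT
  (fun n x => ((p n x - q n x - f x) ^+ 2)%:E) (cst 0%E) (fun x =>
    (f x ^+ 2)%:E).
- by move=> n; exact: measurable_sqr.
- exact: measurable_cst.
- apply: aeW => x _; apply/cvg_EFin; first exact: nearW.
  have -> : 0 = (f^\+ x - f^\- x - f x) * (f^\+ x - f^\- x - f x) :> R.
    by rewrite -fB subrr mul0r.
  rewrite /comp/=; under eq_fun do rewrite expr2.
  have lim : p n x - q n x - f x @[n --> \oo] --> f^\+ x - f^\- x - f x.
    by apply: cvgB; [exact: (cvgB (pl x) (ql x))|exact: cvg_cst].
  exact: (cvgM lim lim).
- apply/integrableP; split; first exact: measurable_sqr.
  by under eq_integral do rewrite gee0_abs ?lee_fin ?sqr_ge0 //.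
- apply: aeW => x n _;
    rewrite gee0_abs ?lee_fin ?sqr_ge0 // -[leLHS]real_normK ?num_real //
    -[leRHS]real_normK ?num_real //.
  rewrite ler_pXn2r ?nnegrE //.
  have := pf n x; have := qf n x; have := p0 n x; have := q0 n x.
  by rewrite fD fB ler_norml; lra.
by rewrite integral0.
Qed.

End square_integrals.

(** * Spectral integrals *)

Section pvm_calculus.
Variables (R : realType) (V : completeNormedModType R[i]).
Variable ip : {dot V for Num.conj}.
Hypothesis ip_norm : forall x : V, `|x| ^+ 2 = ip x x.
Variable E : pvm ip.
Implicit Types (y psi chi : V) (B : set (measurableTypeR R)).
Implicit Types f g : measurableTypeR R -> R.
Local Notation sfunR := {sfun measurableTypeR R >-> R}.

HB.instance Definition _ B := GRing.isLinear.Build _ _ _ _ (pvm_fun E B)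
  (pvm_linear E B).

Lemma rip_pvm B x y : rip ip (E B x) y = rip ip x (E B y).
Proof. by rewrite /rip pvm_sym. Qed.

Lemma hnorm_pvm_sqr B x : hnorm (E B x) ^+ 2 = rip ip (E B x) x.
Proof. by rewrite (hnorm_sqr ip_norm) -rip_pvm pvm_idem. Qed.

Lemma hnorm_pvm_le B x : hnorm (E B x) <= hnorm x.
Proof.
rewrite -(@ler_pXn2r _ 2) // ?nnegrE ?hnorm_ge0 //.
have := sqr_ge0 (hnorm (x - E B x)).
by rewrite (hnormB_sqr ip_norm) (ripC _ x) -hnorm_pvm_sqr; lra.
Qed.

Lemma pvm_measure_hnorm psi B : pvm_measure E psi B = (hnorm (E B psi) ^+ 2)%:E.
Proof. by rewrite hnorm_pvm_sqr. Qed.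

Lemma pvm_measure_set0 psi : pvm_measure E psi set0 = 0%E.
Proof. by rewrite /pvm_measure pvm0 linear0l. Qed.

Lemma pvm_measure_ge0 psi B : (0 <= pvm_measure E psi B)%E.
Proof. by rewrite pvm_measure_hnorm lee_fin sqr_ge0. Qed.

Lemma pvm_measure_sigma_additive psi : semi_sigma_additive (pvm_measure E psi).
Proof.
move=> F mF tF mUF; rewrite /pvm_measure -/(rip ip _ _).
under eq_fun do rewrite sumEFin -raddf_sum -linear_sumlz big_mkord.
apply/cvg_EFin; first exact: nearW.
apply: (cvg_rip ip_norm); exact: pvm_sigma_additive.
Qed.

Lemma pvm_measure_fin psi : fin_num_fun (pvm_measure E psi).
Proof. by []. Qed.

(** [pvm_measure], made to depend on [ip_norm] so that the proof that it is a
measure can be attached to it. *)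
Definition spectral_measure psi : set (measurableTypeR R) -> \bar R :=
  let _ := ip_norm in pvm_measure E psi.

HB.instance Definition _ psi := isMeasure.Build _ _ _ (spectral_measure psi)
  (pvm_measure_set0 psi) (pvm_measure_ge0 psi)
    (@pvm_measure_sigma_additive psi).

HB.instance Definition _ psi :=
  Measure_isFinite.Build _ _ _ (spectral_measure psi)
  (@pvm_measure_fin psi).

Lemma spectral_measureE psi B : spectral_measure psi B = (hnorm (E B psi)
  ^+ 2)%:E.
Proof. exact: pvm_measure_hnorm. Qed.

Local Notation S s psi := (simple_pvm_integral E s psi).

(** Both sides expand over the common refinement of the level sets of [s] and
[t]. The statement is bilinear because the level sets of [s - t] may merge
pieces of that refinement. *)
Lemma rip_simple (s t : sfunR) psi :
  (rip ip (S s psi) (S t psi))%:E =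
    (\int[spectral_measure psi]_x (s x * t x)%:E)%E.
Proof.
pose At a b := s @^-1` [set a] `&` t @^-1` [set b].
have mAt a b : measurable (At a b) by exact: measurableI.
have -> : rip ip (S s psi) (S t psi) =
    \sum_(a <- fset_set (range s)) \sum_(b <- fset_set (range t)) a * b *
      rip ip (E (At a b) psi) psi.
  rewrite /simple_pvm_integral !fsbig_finite // rip_suml; apply: eq_bigr => a _.
  rewrite ripZl ripC rip_suml mulr_sumr; apply: eq_bigr => b _.
  rewrite ripZl mulrA; congr (_ * _).
  by rewrite -rip_pvm -pvmI.
pose F a b x : \bar R := ((a * b)%:E * (\1_(At a b) x)%:E)%E.
have iF a b : (spectral_measure psi).-integrable setT (F a b).
  by apply: integrableZl => //; exact: integrable_indic.
have -> : (\int[spectral_measure psi]_x (s x * t x)%:E =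
    \int[spectral_measure psi]_x
      \sum_(a <- fset_set (range s)) \sum_(b <- fset_set (range t)) F a b x)%E.
  apply: eq_integral => x _; rewrite (fimfunE s) (fimfunE t) !fsbig_finite //.
  rewrite mulr_suml -sumEFin; apply: eq_bigr => a _.
  rewrite mulr_sumr -sumEFin; apply: eq_bigr => b _.
  by rewrite /F -EFinM indicI/= mulrACA.
rewrite integral_sum //; last by move=> a; exact: integrable_sum.
rewrite -sumEFin; apply: eq_bigr => a _.
rewrite integral_sum // -sumEFin; apply: eq_bigr => b _.
rewrite integralZl //; last exact: integrable_indic.
by rewrite integral_indic // setIT EFinM.
Qed.

Lemma simple_isometry (s t : sfunR) psi :
  sqint (spectral_measure psi) (fun x => s x - t x) =
  (hnorm (S s psi - S t psi) ^+ 2)%:E.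
Proof.
have i (u v : sfunR) : (spectral_measure psi).-integrable setT (fun x =>
  (u x * v x)%:E).
  apply: measurable_bounded_integrable => //.
  - exact: ltry.
  - exact: measurable_funM.
  - exact: (simple_bounded (u * v)).
rewrite (hnormB_sqr ip_norm) !(hnorm_sqr ip_norm) EFinB EFinD EFinM !rip_simple.
rewrite -integralD // -integralZl // -integralB //; last 2 first.
- exact: integrableD.
- exact: integrableZl.
apply: eq_integral => x _ /=; rewrite -?EFinM -?EFinD -?EFinB. congr EFin; ring.
Qed.



(** The isometry of the spectral calculus passes from simple functions to the
limit. With [f = g] it says that the vector [chi] is unique, with [g = 0] it
computes its norm. *)
Lemma pvm_integral_isometry f g psi chi chi' :
  measurable_fun setT f -> measurable_fun setT g ->
  is_pvm_integral E f psi chi -> is_pvm_integral E g psi chi' ->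
  sqint (spectral_measure psi) (fun x =>
    f x - g x) = (hnorm (chi - chi') ^+ 2)%:E.
Proof.
move=> mf mg [s sf sc] [t tg tc].
have lim := @sqint_cvgB _ _ _ (spectral_measure psi) (fun n => s n) (fun n =>
  t n) f g
  (fun n => measurable_funPT (s n)) (fun n =>
    measurable_funPT (t n)) mf mg sf tg.
have nlim : hnorm (S (s n) psi - S (t n) psi)
  @[n --> \oo] --> hnorm (chi - chi').
  by apply: cvg_hnorm; exact: (cvgB sc tc).
apply: sqint_cvg lim _ _.
- by move=> n; exact: measurable_funB.
- exact: measurable_funB.
- by move=> n; exact: simple_isometry.
- by rewrite expr2; under eq_fun do rewrite expr2; exact: (cvgM nlim nlim).
Qed.

Lemma is_pvm_integral_cst (a : R) psi : is_pvm_integral E (fun=> a)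
  psi (a%:C *: psi).
Proof.
exists (fun=> cst_sfun a).
  rewrite (_ : (fun n => _) = cst 0%E); first exact: cvg_cst.
  apply/funext => n; change (sqint (spectral_measure psi) (fun=> a - a) = 0%E).
  by rewrite /sqint; under eq_integral do rewrite subrr expr0n;
    exact: integral0.
have -> : S (cst_sfun a) psi = a%:C *: psi; last exact: cvg_cst.
rewrite /simple_pvm_integral (_ : range _ = [set a]) ?fsbig_set1; last first.
  by apply/seteqP; split=> [_ [_ _ <-]//|_ ->]; exists point.
by rewrite (_ : _ @^-1` _ = setT) ?pvmT //; apply/seteqP; split.
Qed.

Lemma is_pvm_integral_exists f psi : measurable_fun setT f ->
  (sqint (spectral_measure psi) f < +oo)%E ->
    exists chi, is_pvm_integral E f psi chi.
Proof.
move=> mf f2; have [s sf] := sqint_sfun_approx mf f2.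
have ms n : measurable_fun setT (s n) by [].
pose d n := sqint (spectral_measure psi) (fun x => s n x - f x).
(* Finitely many of the errors may be infinite, hence the shift by [M]. *)
have [M _ d_fin] : \forall n \near \oo, d n \is a fin_num.
  by have [] := (fine_cvgP _ _).1 sf.
have fin_shift n : d (n + M)%N \is a fin_num by apply: d_fin; exact: leq_addl.
have lim : 2 * fine (d (n + M)%N) @[n --> \oo] --> (0 : R).
  rewrite -(mulr0 2); apply: cvgM; first exact: cvg_cst.
  rewrite (cvg_shiftn M (fine \o d)).
  exact: fine_cvg sf.
(* [f] is square integrable, so the images of the [s n] form a Cauchy sequence
   by the isometry for simple functions. *)
have : cvg ((fun n => S (s (n + M)%N) psi) @ \oo).
  apply: cauchy_hnorm lim _ => m n;
    rewrite -lee_fin -simple_isometry EFinD !EFinM.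
  rewrite !fineK ?fin_shift //; apply: le_sqint => //.
  + exact: measurable_funB.
  + exact: measurable_funB.
  + exact: measurable_funB.
  + move=> x.
    have := sqr_ge0 ((s (m + M)%N x - f x) + (s (n + M)%N x - f x)).
    set p := s _ x; set q := s _ x; lra.
move=> /cvg_ex[chi c_chi]; exists chi, s => //.
by rewrite -(cvg_shiftn M).
Qed.

Lemma fcalcP f psi : measurable_fun setT f -> odom (fcalc E f) psi ->
  is_pvm_integral E f psi (fcalc E f psi).
Proof. by move=> mf /(is_pvm_integral_exists mf)[chi ?];
  exact: (xgetPex 0 (ex_intro _ chi _)). Qed.

Lemma hnorm_fcalcB f g psi : measurable_fun setT f -> measurable_fun setT g ->
  odom (fcalc E f) psi -> odom (fcalc E g) psi ->
  sqint (spectral_measure psi) (fun x => f x - g x) =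
  (hnorm (fcalc E f psi - fcalc E g psi) ^+ 2)%:E.
Proof. by move=> *; apply: pvm_integral_isometry => //; exact: fcalcP. Qed.

Lemma fcalc_eq f psi chi : measurable_fun setT f -> odom (fcalc E f) psi ->
  is_pvm_integral E f psi chi -> fcalc E f psi = chi.
Proof.
move=> mf df fchi.
have := pvm_integral_isometry mf mf (fcalcP mf df) fchi.
rewrite /sqint; under eq_integral do rewrite subrr expr0n.
by rewrite integral0 => -[] /esym/eqP;
  rewrite sqrf_eq0 hnorm_eq0 subr_eq0 => /eqP.
Qed.

Lemma hnorm_fcalc f psi : measurable_fun setT f -> odom (fcalc E f) psi ->
  sqint (spectral_measure psi) f = (hnorm (fcalc E f psi) ^+ 2)%:E.
Proof.
move=> mf df; have := is_pvm_integral_cst 0 psi; rewrite scale0r => i0.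
have := pvm_integral_isometry mf (measurable_cst (0 : R)) (fcalcP mf df) i0.
by rewrite subr0 /sqint; under eq_integral do rewrite subr0.
Qed.

End pvm_calculus.

(** * Spectral projections and concentration of vectors *)

Section projections.
Variables (R : realType) (V : completeNormedModType R[i]).
Variable ip : {dot V for Num.conj}.
Hypothesis ip_norm : forall x : V, `|x| ^+ 2 = ip x x.
Variable E : pvm ip.
Implicit Types (psi chi : V) (A B : set (measurableTypeR R)).
Implicit Types f g : measurableTypeR R -> R.
Local Notation mu := (spectral_measure ip_norm E).

Lemma pvm_commute A B psi : measurable A -> measurable B ->
  E A (E B psi) = E B (E A psi).
Proof. by move=> mA mB; rewrite -!pvmI // setIC. Qed.

(** Pythagoras' theorem, together with the additivity of the measure on [B] and
its complement. *)
Lemma hnorm_pvmC B psi : measurable B ->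
  hnorm (psi - E B psi) = hnorm (E (~` B) psi).
Proof.
move=> mB; apply/eqP; rewrite -(@eqrXn2 _ 2) ?hnorm_ge0 //; apply/eqP.
have : (mu psi setT = mu psi B + mu psi (~` B))%E.
  rewrite -measureU ?setUv ?setICr //; exact: measurableC.
rewrite !spectral_measureE pvmT -EFinD => -[eT].
rewrite (hnormB_sqr ip_norm) ripC -(hnorm_pvm_sqr ip_norm); lra.
Qed.

Lemma pvm_fixC B psi : measurable B -> E B psi = psi -> E (~` B) psi = 0.
Proof.
move=> mB e; apply/eqP; rewrite -hnorm_eq0 -hnorm_pvmC // e subrr.
by rewrite hnorm_eq0.
Qed.

(** [E S] and [E B] commute and [E B] is a contraction. *)
Lemma spectral_measure_proj_le B psi S : measurable B -> measurable S ->
  (mu (E B psi) S <= mu psi S)%E.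
Proof.
move=> mB mS; rewrite !spectral_measureE lee_fin pvm_commute //.
by rewrite ler_pXn2r ?nnegrE ?hnorm_ge0 // (hnorm_pvm_le ip_norm).
Qed.

Lemma sqint_proj_le B psi f : measurable B -> measurable_fun setT f ->
  (sqint (mu (E B psi)) f <= sqint (mu psi) f)%E.
Proof.
move=> mB mf; apply: ge0_le_measure_integral => //.
- by move=> S mS; exact: spectral_measure_proj_le.
- by move=> x; rewrite lee_fin sqr_ge0.
- exact: measurable_sqr.
Qed.

Lemma simple_pvm_integral_proj (s : {sfun measurableTypeR R >-> R}) B psi :
  measurable B -> simple_pvm_integral E s (E B psi)
    = E B (simple_pvm_integral E s psi).
Proof.
move=> mB; rewrite /simple_pvm_integral !fsbig_finite // linear_sum.
by apply: eq_bigr => a _; rewrite linearZ/= pvm_commute.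
Qed.

Lemma is_pvm_integral_proj f B psi chi : measurable B ->
  measurable_fun setT f ->
  is_pvm_integral E f psi chi -> is_pvm_integral E f (E B psi) (E B chi).
Proof.
move=> mB mf [s sf sc]; exists s.
  have lim : sqint (mu psi) (fun x =>
    s n x - f x) @[n --> \oo] --> 0%E by exact: sf.
  apply: (squeeze_cvge _ (@cvg_cst _ _ _ _ _) lim); apply: nearW => n.
  apply/andP; split; first exact: (sqint_ge0 (mu (E B psi))).
  by apply: sqint_proj_le => //; exact: measurable_funB.
apply/cvg_hnormP; move/cvg_hnormP: sc; apply: squeeze_cvgr; last exact: cvg_cst.
apply: nearW => n; rewrite hnorm_ge0/= simple_pvm_integral_proj // -linearB.
exact: hnorm_pvm_le.
Qed.

Lemma odom_fcalcE f psi : odom (fcalc E f) psi = (sqint (mu psi) f < +oo)%E.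
Proof. by []. Qed.

Lemma fcalc_proj f B psi : measurable B -> measurable_fun setT f ->
  odom (fcalc E f) psi ->
  odom (fcalc E f) (E B psi) /\ fcalc E f (E B psi) = E B (fcalc E f psi).
Proof.
move=> mB mf df.
have df' : odom (fcalc E f) (E B psi).
  by rewrite odom_fcalcE; apply: le_lt_trans df; exact: sqint_proj_le.
split=> //; apply: (fcalc_eq ip_norm) => //; apply: is_pvm_integral_proj => //.
exact: (fcalcP ip_norm).
Qed.

(** A vector in the range of [E B] has a distribution carried by [B], so only
the values on [B] matter. *)
Lemma sqint_concentrated f g B psi : measurable B -> E B psi = psi ->
  measurable_fun setT f -> measurable_fun setT g ->
  (forall l, B l -> f l ^+ 2 <= g l ^+ 2) ->
    (sqint (mu psi) f <= sqint (mu psi) g)%E.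
Proof.
move=> mB e mf mg fg; apply: ae_ge0_le_integral => //.
- by move=> x _; rewrite lee_fin sqr_ge0.
- exact: measurable_sqr.
- by move=> x _; rewrite lee_fin sqr_ge0.
- exact: measurable_sqr.
exists (~` B); split; first exact: measurableC.
  apply: (etrans (spectral_measureE ip_norm E _ _)); rewrite pvm_fixC //.
  by rewrite (eqP (_ : hnorm 0 == 0)) ?expr0n // hnorm_eq0.
by move=> l /= nfg Bl; apply: nfg => _; rewrite lee_fin fg.
Qed.

Lemma spectral_integral_cst psi (a : R) :
  (\int[mu psi]_l a%:E = (a * hnorm psi ^+ 2)%:E)%E.
Proof.
rewrite integral_cst // EFinM; congr (_ * _)%E.
by rewrite -[in RHS](pvmT E psi); exact: spectral_measureE.
Qed.

Lemma sqint_cst (a : R) psi : sqint (mu psi) (fun=> a) = ((a * hnorm psi)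
  ^+ 2)%:E.
Proof. by rewrite /sqint spectral_integral_cst exprMn. Qed.

Lemma hnorm_resolvent (a : R) psi : odom (fcalc E id) psi ->
  sqint (mu psi) (fun l =>
    l - a) = (hnorm (fcalc E id psi - a%:C *: psi) ^+ 2)%:E.
Proof.
move=> d; apply: pvm_integral_isometry => //; first exact: (fcalcP ip_norm).
exact: is_pvm_integral_cst.
Qed.

(** On the range of a spectral projection of a bounded set the operator is
bounded and leaves the range invariant, so the bound can be iterated. *)
Lemma concentrated_bound (a r : R) B psi : 0 <= r -> measurable B ->
  E B psi = psi ->
  (forall l, B l -> `|l - a| <= r) ->
  [/\ odom (fcalc E id) psi,
      hnorm (fcalc E id psi - a%:C *: psi) <= r * hnorm psi &
      E B (fcalc E id psi - a%:C *: psi) = fcalc E id psi - a%:C *: psi].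
Proof.
move=> r0 mB e Br.
have d : odom (fcalc E id) psi.
  rewrite odom_fcalcE; apply: (@le_lt_trans _ _ (sqint (mu psi)
    (fun=> `|a| + r))).
    apply: (sqint_concentrated mB e) => // l /Br lr.
    rewrite -real_normK ?num_real // ler_pXn2r ?nnegrE ?addr_ge0 //.
    by have := ler_normD (l - a) a; rewrite subrK; lra.
  by rewrite sqint_cst ltry.
split => //; last first.
  by rewrite linearB linearZ/= e;
    have [_] := fcalc_proj mB (@measurable_id _ _ _) d; rewrite e => <-.
rewrite -(@ler_pXn2r _ 2) // ?nnegrE ?mulr_ge0 ?hnorm_ge0 //.
rewrite -lee_fin -hnorm_resolvent // -sqint_cst.
apply: (sqint_concentrated mB e) => //; first exact: measurable_funB.
by move=> l /Br lr; rewrite -real_normK ?num_real // ler_pXn2r ?nnegrE.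
Qed.

(** The part of [psi] carried by [A] is stretched at least by the factor [q]
under [H - a], because the projection commutes with [H]. *)
Lemma away_bound (a q : R) A psi : 0 <= q -> measurable A ->
  (forall l, A l -> q <= `|l - a|) -> odom (fcalc E id) psi ->
  q * hnorm (E A psi) <= hnorm (E A (fcalc E id psi - a%:C *: psi)).
Proof.
move=> q0 mA Aq d; have [dA eA] := fcalc_proj mA (@measurable_id _ _ _) d.
rewrite linearB linearZ/= -eA.
rewrite -(@ler_pXn2r _ 2) // ?nnegrE ?mulr_ge0 ?hnorm_ge0 //.
rewrite -lee_fin -hnorm_resolvent // -sqint_cst.
apply: (sqint_concentrated mA) => //; first exact: pvm_idem.
  exact: measurable_funB.
by move=> l /Aq lr; rewrite -[leRHS]real_normK ?num_real // ler_pXn2r ?nnegrE.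
Qed.

End projections.

(** * Uniqueness of the spectral measure *)

Section geometric.
Variable R : realType.

Lemma geometric_gap (r q x y : R) : 0 <= r -> r < q -> 0 <= x ->
  (forall n, q ^+ n * x <= r ^+ n * y) -> x = 0.
Proof.
move=> r0 rq x0 h; have q0 : 0 < q by exact: le_lt_trans rq.
have bnd n : x <= (r / q) ^+ n * y.
  by rewrite expr_div_n mulrAC ler_pdivlMr ?exprn_gt0 // mulrC.
have lim : (r / q) ^+ n * y @[n --> \oo] --> 0 * y.
  apply: cvgM; last exact: cvg_cst.
  apply: cvg_expr.
  by rewrite ger0_norm ?divr_ge0 ?(ltW q0) // ltr_pdivrMr // mul1r.
apply/eqP; rewrite eq_le x0 andbT -(mul0r y).
by apply: (cvgr_to_ge lim); exact: nearW.
Qed.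

End geometric.

Section spectral_uniqueness.
Variables (R : realType) (V : completeNormedModType R[i]).
Variable ip : {dot V for Num.conj}.
Hypothesis ip_norm : forall x : V, `|x| ^+ 2 = ip x x.
Implicit Types (E F : pvm ip) (psi : V).
Local Notation seg a r := (`[a - r, a + r]%classic : set (measurableTypeR R)).

Lemma segP (a r l : R) : seg a r l <-> `|l - a| <= r.
Proof. by rewrite /= in_itv/= ler_distl. Qed.

Lemma measurable_away (a q : R) :
  measurable ([set l | q <= `|l - a|] : set (measurableTypeR R)).
Proof.
rewrite (_ : [set _ | _] = ~` `]a - q, a + q[%classic).
  by apply: measurableC; exact: measurable_itv.
by apply/seteqP; split=> l /=; rewrite in_itv/= -ltr_distl leNgt => /negP.
Qed.

(** The complement of the closed segment is the countable union of the sets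
[{l | r + 1/(k+1) <= |l - a|}]. *)
Lemma pvm_fix_limit E (a r : R) psi :
  (forall q, r < q -> E [set l | q <= `|l - a|] psi = 0) ->
    E (seg a r) psi = psi.
Proof.
move=> h; have mI : measurable (seg a r) by exact: measurable_itv.
apply/esym/eqP; rewrite -subr_eq0 -hnorm_eq0 (hnorm_pvmC ip_norm) //.
rewrite -sqrf_eq0; apply/eqP; apply: EFin_inj.
rewrite -(spectral_measureE ip_norm); apply: measure_negligible;
  first exact: measurableC.
apply: (negligibleS
  (A := \bigcup_k [set l : measurableTypeR R | r + k.+1%:R^-1 <= `|l - a|])).
  move=> l /= /segP/negP; rewrite -ltNge => rl.
  have [k] := ltr_add_invr rl.
  by exists k => //=; exact: ltW.
apply: negligible_bigcup => k; apply/negligibleP; first exact: measurable_away.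
apply: (etrans (spectral_measureE ip_norm E _ _)).
by rewrite h ?ltrDl // (eqP (_ : hnorm 0 == 0)) ?expr0n // hnorm_eq0.
Qed.

(** Both projections see the same operator [next = H - a]. For [F], which
resolves [H + c], the vector [psi] is concentrated at distance at most [r], so
that [||next^n psi|| <= r^n ||psi||]. If [psi] had a part at distance at least
[q > r] for [E], that part would grow at least like [q^n]. *)
Lemma concentration_transfer E F (c a r : R) psi : 0 <= r ->
  (forall chi, odom (fcalc F id) chi -> odom (fcalc E id) chi /\
     fcalc F id chi = fcalc E id chi + c%:C *: chi) ->
  F (seg (a + c) r) psi = psi -> E (seg a r) psi = psi.
Proof.
move=> r0 FE fpsi.
have mJ : measurable (seg (a + c) r) by exact: measurable_itv.
pose next chi := fcalc E id chi - a%:C *: chi.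
have bound chi : F (seg (a + c) r) chi = chi ->
    [/\ odom (fcalc E id) chi, hnorm (next chi) <= r * hnorm chi &
        F (seg (a + c) r) (next chi) = next chi].
  move=> fchi.
  have [l /segP//|d] := concentrated_bound ip_norm (a := a + c) r0 mJ fchi.
  have [dE ->] := FE _ d.
  by rewrite rmorphD/= scalerDl opprD addrACA subrr addr0.
have iter_bound n : F (seg (a + c) r) (iter n next psi) = iter n next psi /\
    hnorm (iter n next psi) <= r ^+ n * hnorm psi.
  elim: n => [|n [fn le_n]]; first by rewrite mul1r.
  have [_ le_next f_next] := bound _ fn; split=> //=.
  by rewrite exprS -mulrA (le_trans le_next) // ler_wpM2l.
apply: pvm_fix_limit => q rq; set A := [set l | _].
have mA : measurable A by exact: measurable_away.
have q0 : 0 <= q by exact: le_trans (ltW rq).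
have growth n : q ^+ n * hnorm (E A psi) <= hnorm (E A (iter n next psi)).
  elim: n => [|n IHn]; first by rewrite mul1r.
  have [dn _ _] := bound _ (iter_bound n).1.
  rewrite exprS -mulrA (le_trans (ler_wpM2l q0 IHn)) //=.
  exact: (away_bound ip_norm).
apply/eqP; rewrite -hnorm_eq0; apply/eqP.
apply: (geometric_gap r0 rq (hnorm_ge0 _)) => n.
apply: le_trans (growth n) (le_trans (hnorm_pvm_le ip_norm _ _ _)
  (iter_bound n).2).
Qed.

(** By [concentration_transfer], used in both directions, the two projections
have the same range, and orthogonal projections are determined by their range.
  *)
Lemma pvm_shift_seg E F (c a r : R) psi : 0 <= r ->
  odom (fcalc F id) = odom (fcalc E id) ->
  (forall chi, odom (fcalc E id) chi ->
     fcalc F id chi = fcalc E id chi + c%:C *: chi) ->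
  hnorm (F (seg (a + c) r) psi) = hnorm (E (seg a r) psi).
Proof.
move=> r0 dFE FE.
have EF x : E (seg a r) (F (seg (a + c) r) x) = F (seg (a + c) r) x.
  apply: (@concentration_transfer E F c) => //; last by rewrite pvm_idem.
  by move=> chi; rewrite dFE => d; split; last exact: FE.
have FEx x : F (seg (a + c) r) (E (seg a r) x) = E (seg a r) x.
  apply: (@concentration_transfer F E (- c)) => //;
    last by rewrite addrK pvm_idem.
  move=> chi d; rewrite dFE; split=> //.
  by rewrite FE // rmorphN scaleNr addrK.
apply/eqP; rewrite -(@eqrXn2 _ 2) ?hnorm_ge0 //.
rewrite !(hnorm_pvm_sqr ip_norm) -EF rip_pvm ripC -rip_pvm FEx.
by rewrite rip_pvm ripC.
Qed.

(** Closed half-lines, which generate the Borel sets, are increasing unions of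
closed intervals. *)
Lemma closed_itv_generate :
  @measurable _ (measurableTypeR R) =
  <<s [set A : set (measurableTypeR R) |
        exists x y : R, A = `[x, y]%classic] >>.
Proof.
set G := [set A | _]; apply/seteqP; split=> A; last first.
  apply: smallest_sub; first exact: sigma_algebra_measurable.
  by move=> _ [x [y ->]]; exact: measurable_itv.
rewrite -[measurable]/((@ocitv R).-sigma.-measurable) RGenCInfty.measurableE.
apply: smallest_sub; first exact: smallest_sigma_algebra.
move=> _ [x ->]; rewrite itv_bndy_bigcup_BRight.
apply: sigma_algebra_bigcup => n; apply: sub_sigma_algebra.
by exists x, (x + n%:R).
Qed.

Definition translation (c : R) (l : measurableTypeR R)
  : measurableTypeR R := l - c.

Lemma measurable_translation (c : R) : measurable_fun setT (translation c).
Proof. exact: measurable_funB. Qed.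

HB.instance Definition _ c :=
  isMeasurableFun.Build _ _ _ _ _ (measurable_translation c).

Lemma spectral_measure_shift E F (c : R) psi :
  odom (fcalc F id) = odom (fcalc E id) ->
  (forall chi, odom (fcalc E id) chi ->
     fcalc F id chi = fcalc E id chi + c%:C *: chi) ->
  forall A, measurable A ->
  spectral_measure ip_norm E psi A =
  pushforward (spectral_measure ip_norm F psi) (translation c) A.
Proof.
move=> dFE FE; apply: (@measure_unique _ R (measurableTypeR R) _
  (fun n => `[- n%:R, n%:R]%classic) closed_itv_generate).
- move=> _ _ [x [y ->]] [x' [y' ->]]; exists (Num.max x x'), (Num.min y y').
  apply/seteqP; split=> l /=; rewrite !in_itv/= ge_max le_min.
    by move=> [/andP[-> ->] /andP[-> ->]].
  by move=> /andP[/andP[-> ->] /andP[-> ->]].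
- by move=> n; exists (- n%:R), n%:R.
- exact: bigcup_itvT.
- move=> _ [x [y ->]]; have [xy|yx] := leP x y; last first.
    by rewrite set_itv_ge ?measure0 // bnd_simp -ltNge.
  have r0 : 0 <= (y - x) / 2 by lra.
  have := pvm_shift_seg ((x + y) / 2) psi r0 dFE FE.
  have [-> ->] : (x + y) / 2 - (y - x) / 2 = x /\ (x + y) / 2 + (y - x) / 2 = y.
    by split; field.
  move=> e; apply: (etrans (spectral_measureE ip_norm E _ _)).
  apply/esym; apply: (etrans (spectral_measureE ip_norm F _ _)).
  rewrite -e; congr (hnorm (F _ _) ^+ 2)%:E.
  by apply/seteqP; split=> l /=; rewrite !in_itv/= /translation; lra.
- by move=> n; exact: ltry.
Qed.

Lemma integral_spectral_shift E F (c : R) psi (f : measurableTypeR R -> R) :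
  odom (fcalc F id) = odom (fcalc E id) ->
  (forall chi, odom (fcalc E id) chi ->
     fcalc F id chi = fcalc E id chi + c%:C *: chi) ->
  measurable_fun setT f -> (forall l, 0 <= f l) ->
  (\int[spectral_measure ip_norm F psi]_l (f (l - c))%:E =
   \int[spectral_measure ip_norm E psi]_l (f l)%:E)%E.
Proof.
move=> dFE FE mf f0.
rewrite [RHS](eq_measure_integral
  (pushforward (spectral_measure ip_norm F psi) (translation c))); last first.
  by move=> A mA _; exact: spectral_measure_shift.
rewrite ge0_integral_pushforward //; first exact/measurable_EFinP.
by move=> l _; rewrite lee_fin.
Qed.

End spectral_uniqueness.

(** * The operators exp_phi(H - beta) *)

Lemma cvg_dist_mul0 (R : realType) (b C : R) :
  `|b - t| * C @[t --> b] --> (0 : R).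
Proof.
rewrite -(mul0r C); apply: cvgM; last exact: cvg_cst.
apply/cvgrPdist_lt => e e0; near=> t; rewrite sub0r normrN normr_id.
by near: t; exact: cvgr_dist_lt.
Unshelve. all: by end_near. Qed.

Section expphi_of_H.
Variables (R : realType) (V : completeNormedModType R[i]).
Variable ip : {dot V for Num.conj}.
Hypothesis ip_norm : forall x : V, `|x| ^+ 2 = ip x x.
Variable E : pvm ip.
Implicit Types psi : V.
Local Notation mu := (spectral_measure ip_norm E).
Local Notation T := (measurableTypeR R).

Definition expphi_mean psi (b : R)
  : \bar R := (\int[mu psi]_l (expphi (l - b))%:E)%E.

Lemma expphi_meanE psi b :
  expphi_mean psi b = (\int[mu psi]_l (expphi (l - b))%:E)%E.
Proof. by []. Qed.

Lemma sqint_sqrt_expphi psi b :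
  sqint (mu psi) (fun l => Num.sqrt (expphi (l - b))) = expphi_mean psi b.
Proof. by apply: eq_integral => l _;
  rewrite sqr_sqrtr // ltW // expphi_gt0. Qed.

Lemma measurable_sqrt_comp (f : T -> R) : measurable_fun setT f ->
  measurable_fun setT (fun l => Num.sqrt (f l)).
Proof.
apply: (measurableT_comp (f := @Num.sqrt R)).
by apply: continuous_measurable_fun => x; exact: sqrt_continuous.
Qed.

Lemma measurable_sqrt_expphi b :
  measurable_fun setT (fun l : T => Num.sqrt (expphi (l - b))).
Proof. by apply: measurable_sqrt_comp; exact: measurable_expphi_shift. Qed.

Lemma hnorm_sqrt_expphi psi b : (expphi_mean psi b < +oo)%E ->
  (hnorm (sqrt_expphi_op E b psi) ^+ 2)%:E = expphi_mean psi b.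
Proof.
move=> fin; rewrite -sqint_sqrt_expphi (hnorm_fcalc ip_norm) //.
  exact: measurable_sqrt_expphi.
by rewrite odom_fcalcE sqint_sqrt_expphi.
Qed.

Lemma sqrt_abs_integrable psi : odom (sqrt_abs_op E) psi ->
  (mu psi).-integrable setT (fun l : T => l%:E).
Proof.
move=> d; apply/integrableP; split; first by apply/measurable_EFinP.
rewrite odom_fcalcE in d.
have -> : (\int[mu psi]_l `|l%:E|)%E = sqint (mu psi) (fun l => Num.sqrt `|l|);
  last exact: d.
by apply: eq_integral => l _; rewrite sqr_sqrtr.
Qed.

(** [expphi (l - b)] is at most [1 + |b| + |l|], and the distribution of [psi]
is a finite measure. *)
Lemma expphi_integrable psi b : odom (sqrt_abs_op E) psi ->
  (mu psi).-integrable setT (fun l : T => (expphi (l - b))%:E).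
Proof.
move=> /sqrt_abs_integrable il.
have ic : (mu psi).-integrable setT (fun l : T => (1 + `|b|)%:E).
  exact: finite_measure_integrable_cst.
have := integrableD measurableT ic (integrable_abse il).
apply: le_integrable => //; first by apply/measurable_EFinP;
  exact: measurable_expphi_shift.
move=> l _ /=; rewrite lee_fin (ger0_norm (ltW (expphi_gt0 _)))
  ger0_norm ?addr_ge0 //.
by rewrite (le_trans (expphi_le _)) // -addrA lerD2l addrC ler_normB.
Qed.

Lemma odom_sqrt_expphi psi b : odom (sqrt_abs_op E) psi ->
  odom (sqrt_expphi_op E b) psi.
Proof.
move=> /(expphi_integrable b) i; rewrite odom_fcalcE sqint_sqrt_expphi.
by have := integrable_lty measurableT i.
Qed.

(** This is [|l| <= 1 + l^2] for a finite measure. *)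
Lemma odom_id_sqrt_abs psi : odom (fcalc E id) psi -> odom (sqrt_abs_op E) psi.
Proof.
rewrite !odom_fcalcE => d.
apply: (@le_lt_trans _ _ (1%:E * sqint (mu psi) (fun=> 1%R)
  + 1%:E * sqint (mu psi) id)%E).
  apply: le_sqint => //.
  - by apply: measurable_sqrt_comp; exact: normr_measurable.
  - move=> l; rewrite sqr_sqrtr // expr1n !mul1r.
    have : 0 <= (`|l| - 1) ^+ 2 by exact: sqr_ge0.
    by rewrite sqrrB expr1n real_normK ?num_real // mulr1; have := sqr_ge0 l;
      lra.
by rewrite sqint_cst !mul1e lte_add_pinfty // ltry.
Qed.

Lemma expphi_mean_fin psi b : odom (sqrt_abs_op E) psi ->
  expphi_mean psi b \is a fin_num.
Proof. by move=> /(expphi_integrable b) /integrable_fin_num; apply. Qed.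

Lemma hnorm_sqrt_expphi_dom psi : odom (sqrt_abs_op E) psi ->
  forall b, (hnorm (sqrt_expphi_op E b psi) ^+ 2)%:E = expphi_mean psi b.
Proof. by move=> d b; apply: hnorm_sqrt_expphi;
  rewrite ltey_eq expphi_mean_fin. Qed.

(** The difference of the integrands is positive everywhere: if its integral
vanished, the whole line would be negligible, that is [psi] would be [0]. *)
Lemma expphi_mean_lt psi b b' : psi != 0 -> odom (sqrt_abs_op E) psi ->
  b < b' ->
  (expphi_mean psi b' < expphi_mean psi b)%E.
Proof.
move=> psi0 d bb'.
have ib := expphi_integrable b d; have ib' := expphi_integrable b' d.
have pos l : 0 < expphi (l - b) - expphi (l - b').
  by rewrite subr_gt0; apply: ltr_expphi; lra.
rewrite -sube_gt0 /expphi_mean -integralB // lt0e; apply/andP; split;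
  last first.
  by apply: integral_ge0 => l _; rewrite -EFinB lee_fin ltW.
apply/eqP => i0.
have mf : measurable_fun setT (fun l : T =>
  ((expphi (l - b))%:E - (expphi (l - b'))%:E)%E).
  by apply: emeasurable_funB; [case/integrableP: ib|case/integrableP: ib'].
have [N [mN N0 subN]] : ae_eq (mu psi) setT
    (fun l : T => ((expphi (l - b))%:E - (expphi (l - b'))%:E)%E) (cst 0%E).
  apply/(ae_eq_integral_abs (mu psi) measurableT mf); rewrite -[RHS]i0.
  by apply: eq_integral => l _; rewrite gee0_abs // -EFinB lee_fin ltW.
have NT : N = setT.
  apply/seteqP; split=> // l _; apply: subN => /= /(_ Logic.I); rewrite -EFinB.
  by move=> [/eqP]; rewrite gt_eqF.
move: N0; rewrite NT => /(etrans (esym (spectral_measureE ip_norm E psi setT))).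
by rewrite pvmT => -[/eqP]; rewrite sqrf_eq0 hnorm_eq0 (negbTE psi0).
Qed.

Lemma expphi_shift_lipschitz (b b' l : R) : `|expphi (l - b)
  - expphi (l - b')| <= `|b - b'|.
Proof.
apply: le_trans (expphi_lipschitz _ _) _.
have -> : l - b - (l - b') = b' - b by ring.
by rewrite distrC.
Qed.

(** [expphi (l - b)] and [expphi (l - b')] differ by a bounded function of [l],
and the measure is finite. *)
Lemma odom_expphi_op b b' psi : odom (expphi_op E b) psi ->
  odom (expphi_op E b') psi.
Proof.
rewrite !odom_fcalcE => d.
apply: (@le_lt_trans _ _ (2%:E * sqint (mu psi) (fun l => expphi (l - b)%R) +
  2%:E * sqint (mu psi) (fun=> (b - b')%R))%E).
  apply: le_sqint => //; try exact: measurable_expphi_shift.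
  move=> l; have := expphi_shift_lipschitz b b' l.
  rewrite -(@ler_pXn2r _ 2) // ?nnegrE // !real_normK ?num_real //.
  set p := expphi _; set q := expphi _.
  have := sqr_ge0 (2 * p - q); lra.
rewrite sqint_cst; apply: lte_add_pinfty; first exact: lte_mul_pinfty.
by rewrite -EFinM ltry.
Qed.

Lemma hnorm_expphi_opB b b' psi : odom (expphi_op E b) psi ->
  hnorm (expphi_op E b psi - expphi_op E b' psi) <= `|b - b'| * hnorm psi.
Proof.
move=> d; have d' := odom_expphi_op b' d.
rewrite -(@ler_pXn2r _ 2) // ?nnegrE ?mulr_ge0 ?hnorm_ge0 //.
have m a := measurable_expphi_shift (R := R) a.
rewrite -lee_fin -(hnorm_fcalcB ip_norm (m b) (m b') d d')
  -(sqint_cst ip_norm E).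
apply: le_sqint1 => //; first exact: measurable_funB.
move=> l; rewrite -[leLHS]real_normK ?num_real //.
by rewrite ler_pXn2r ?nnegrE // expphi_shift_lipschitz.
Qed.

Lemma continuous_expphi_op psi : (forall b, odom (expphi_op E b) psi) ->
  continuous (fun b : R => expphi_op E b psi).
Proof.
move=> d b; apply/cvg_hnormP.
apply: (squeeze_cvgr _ (@cvg_cst _ _ _ _ _) (cvg_dist_mul0 b (hnorm psi)));
  apply: nearW => t.
by rewrite hnorm_ge0/= hnorm_expphi_opB.
Qed.

End expphi_of_H.

(** * The norm of the square root as a function of beta *)

Section expphi_profile.
Variables (R : realType) (V : completeNormedModType R[i]).
Variable ip : {dot V for Num.conj}.
Hypothesis ip_norm : forall x : V, `|x| ^+ 2 = ip x x.
Variables (E : pvm ip) (psi : V).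
Local Notation mu := (spectral_measure ip_norm E psi).
Local Notation T := (measurableTypeR R).
Hypothesis psi_dom : odom (sqrt_abs_op E) psi.
(** [N b] stands for the norm of [[exp_phi(H - b)]^{1/2} psi]: being nonnegative
and having the mean of [exp_phi(H - b)] as its square is all that the argument
uses. *)
Variable N : R -> R.
Hypothesis N_ge0 : forall b, 0 <= N b.
Hypothesis N_sqr : forall b, (N b ^+ 2)%:E = expphi_mean ip_norm E psi b.

Lemma profile_decreasing b b' : psi != 0 -> b < b' -> N b' < N b.
Proof.
move=> psi0 bb'; rewrite -(@ltr_pXn2r _ 2) ?nnegrE // -lte_fin !N_sqr.
exact: expphi_mean_lt.
Qed.

Lemma profile_sqr_le b b' : N b ^+ 2 <= N b' ^+ 2 + `|b - b'| * hnorm psi ^+ 2.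
Proof.
rewrite -lee_fin EFinD !N_sqr -(spectral_integral_cst ip_norm E).
have i a := expphi_integrable ip_norm a psi_dom.
have ic : mu.-integrable setT (fun l : T => `|b - b'|%:E).
  exact: finite_measure_integrable_cst.
rewrite /expphi_mean -integralD //; apply: le_integral => //;
  first exact: integrableD.
move=> l _; rewrite -EFinD lee_fin.
by have := expphi_shift_lipschitz b b' l; rewrite ler_norml; lra.
Qed.

Lemma continuous_profile_sqr : continuous (fun b => N b ^+ 2).
Proof.
move=> b; apply/cvgrPdist_lt => e e0; near=> t.
apply: (@le_lt_trans _ _ (`|b - t| * hnorm psi ^+ 2)).
  rewrite ler_norml; have := profile_sqr_le b t; have := profile_sqr_le t b.
  by rewrite (distrC t b); lra.
by near: t; apply: cvgr_lt e e0; exact: cvg_dist_mul0.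
Unshelve. all: by end_near. Qed.

(** The affine lower bound of [expphi] is integrated against the probability
measure of mean [0] attached to [psi]. *)
Lemma profile_sqr_ge b : hnorm psi = 1 -> vector_mean E psi = 0%E ->
  1 - b / 2 <= N b ^+ 2.
Proof.
move=> psi1 mean0; rewrite -lee_fin N_sqr.
have il := sqrt_abs_integrable ip_norm psi_dom.
have i2 : mu.-integrable setT (fun l : T => (2^-1%:E * l%:E)%E).
  exact: integrableZl.
have ic : mu.-integrable setT (fun l : T => (1 - b / 2)%:E).
  exact: finite_measure_integrable_cst.
have -> : (1 - b / 2)%:E = (\int[mu]_l ((1 - b / 2)%:E + 2^-1%:E * l%:E))%E.
  rewrite integralD // spectral_integral_cst psi1 expr1n mulr1 integralZl //.
  by rewrite [X in (_ * X)%E](mean0 : (\int[mu]_l l%:E)%E = 0%E) mule0 adde0.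
apply: le_integral => //; first exact: integrableD.
  exact: expphi_integrable.
move=> l _; rewrite -EFinM -EFinD lee_fin.
by apply: le_trans (expphi_ge _); lra.
Qed.

(** [expphi (l - n)] decreases with [n], so [expphi l] dominates, and it is at
most [exp (l + 1 - n)]. *)
Lemma profile_sqr_cvg0 : N n%:R ^+ 2 @[n --> \oo] --> (0 : R).
Proof.
have [|||||_ _ lim] := @dominated_convergence _ _ _ mu _ measurableT
  (fun n (l : T) => (expphi (l - n%:R))%:E) (cst 0%E) (fun l =>
    (expphi (l - 0))%:E).
- by move=> n; apply/measurable_EFinP; exact: measurable_expphi_shift.
- exact: measurable_cst.
- apply: aeW => l _; apply/cvg_EFin; first exact: nearW.
  have lim : expR (l + 1) * expR (- 1) ^+ n @[n --> \oo] --> (0 : R).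
    rewrite -(mulr0 (expR (l + 1))); apply: cvgM; first exact: cvg_cst.
    apply: cvg_expr.
    by rewrite ger0_norm ?expR_ge0 // -expR0 ltr_expR; lra.
  apply: (squeeze_cvgr _ (@cvg_cst _ _ _ _ _) lim); apply: nearW => n.
  rewrite (ltW (expphi_gt0 _)) /= (le_trans (expphi_le_expR _)) //.
  rewrite -expRM_natl -expRD ler_expR; lra.
- exact: expphi_integrable.
- apply: aeW => l n _; rewrite gee0_abs ?lee_fin ?(ltW (expphi_gt0 _)) //.
  have [->//|n0] := eqVneq n 0%N; apply: ltW; apply: ltr_expphi.
  have : 0 < n%:R :> R by rewrite ltr0n lt0n.
  lra.
rewrite integral0 in lim.
rewrite (_ : (fun n => _) = fine \o (fun n => expphi_mean ip_norm E psi n%:R)).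
  exact: (fine_cvg lim).
by apply/funext => n; rewrite /= -N_sqr.
Qed.

Lemma profile_inj : psi != 0 -> injective N.
Proof.
move=> psi0 b b' e; have [h|h|//] := ltgtP b b';
  by have := profile_decreasing psi0 h; rewrite e ltxx.
Qed.

Lemma profile_surj (y : R) : hnorm psi = 1 -> vector_mean E psi = 0%E ->
  0 < y -> exists b, N b = y.
Proof.
move=> psi1 mean0 y0; have y20 : 0 < y ^+ 2 by rewrite exprn_gt0.
have [n _ Hn] := cvgr_lt _ profile_sqr_cvg0 _ y20.
have {}Hn : N n%:R ^+ 2 < y ^+ 2 by exact: (Hn n (leqnn _)).
(* At this point the affine lower bound takes the value [1 + y ^+ 2]. *)
pose a : R := - (2 * y ^+ 2).
have an : a <= n%:R by rewrite (@le_trans _ _ 0) // oppr_le0 mulr_ge0 // ltW.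
have Ha : y ^+ 2 <= N a ^+ 2.
  by apply: le_trans (profile_sqr_ge a psi1 mean0); rewrite /a; lra.
have [||b _ eb] := @IVT R (fun b => N b ^+ 2) a n%:R (y ^+ 2) an.
- by apply: continuous_subspaceT; exact: continuous_profile_sqr.
- by rewrite ge_min (ltW Hn) orbT le_max Ha.
by exists b; apply/eqP; rewrite -(@eqrXn2 _ 2) ?(ltW y0) ?eb.
Qed.

Lemma profile_bij : hnorm psi = 1 -> vector_mean E psi = 0%E ->
  set_bij setT `]0, +oo[ N.
Proof.
move=> psi1 mean0; have psi0 : psi != 0 by rewrite -hnorm_eq0 psi1 oner_neq0.
split.
- move=> b _ /=; rewrite in_itv/= andbT.
  by apply: le_lt_trans (N_ge0 (b + 1)) (profile_decreasing psi0 _);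
    rewrite ltrDl.
- by move=> b b' _ _; exact: profile_inj.
- move=> y /=; rewrite in_itv/= andbT => y0.
  by have [b eb] := profile_surj psi1 mean0 y0; exists b.
Qed.

Lemma profile_root : hnorm psi = 1 -> vector_mean E psi = 0%E ->
  exists! alpha, 0 <= alpha /\ N alpha = 1.
Proof.
move=> psi1 mean0; have psi0 : psi != 0 by rewrite -hnorm_eq0 psi1 oner_neq0.
have [a ea] := profile_surj psi1 mean0 ltr01; exists a; split.
  (* At a negative [a] the affine lower bound exceeds [1]. *)
  split=> //; rewrite leNgt; apply/negP => a0.
  by have := profile_sqr_ge a psi1 mean0; rewrite ea expr1n; lra.
by move=> a' [_ ea']; apply: profile_inj => //; rewrite ea ea'.
Qed.

End expphi_profile.

(** * The theorem *)

Theorem proposition3p2 (R : realType) (V : completeNormedModType R[i])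
    (ip : {dot V for Num.conj}) (ip_norm : forall x : V, `|x| ^+ 2 = ip x x)
    (H : operator V) (H_sa : self_adjoint ip H)
    (E : pvm ip) (HE : spectral_resolution E H) :
  [/\ (forall Psi, odom (sqrt_abs_op E) Psi ->
         forall beta, odom (sqrt_expphi_op E beta) Psi),
      (forall beta beta', odom (expphi_op E beta) = odom (expphi_op E beta')) /\
      (forall psi, (forall beta, odom (expphi_op E beta) psi) ->
         continuous (fun beta : R => expphi_op E beta psi)),
      (forall Psi, Psi != 0 -> odom H Psi ->
         forall beta beta', beta < beta' ->
           hnorm (sqrt_expphi_op E beta' Psi) <
           hnorm (sqrt_expphi_op E beta Psi)) &
      forall Omega, hnorm Omega = 1 -> odom (sqrt_abs_op E) Omega ->
        vector_mean E Omega = 0%E ->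
        [/\ set_bij setT `]0, +oo[
              (fun beta => hnorm (sqrt_expphi_op E beta Omega)),
            (exists! alpha, 0 <= alpha /\
               hnorm (sqrt_expphi_op E alpha Omega) = 1) &
            forall alpha, 0 <= alpha ->
              hnorm (sqrt_expphi_op E alpha Omega) = 1 ->
              forall (c : R) (E' : pvm ip),
                spectral_resolution E' (op_shift H c) ->
                unique (fun beta =>
                          hnorm (sqrt_expphi_op E' beta Omega) = 1)
                       (alpha + c)]].
Proof.
have [dH appH] := HE; split.
- by move=> Psi d beta; exact: (odom_sqrt_expphi ip_norm).
- split; last exact: continuous_expphi_op.
  by move=> b b'; apply/seteqP; split=> psi; exact: (odom_expphi_op ip_norm).
- move=> Psi Psi0; rewrite dH => /(odom_id_sqrt_abs ip_norm) d b b'.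
  exact: (profile_decreasing d (fun=> hnorm_ge0 _)
    (hnorm_sqrt_expphi_dom ip_norm d)).
move=> Omega Omega1 d mean0.
have Omega0 : Omega != 0 by rewrite -hnorm_eq0 Omega1 oner_neq0.
have N_ge0 b : 0 <= hnorm (sqrt_expphi_op E b Omega) by exact: hnorm_ge0.
have N_sqr := hnorm_sqrt_expphi_dom ip_norm d.
split; [exact: (profile_bij d N_ge0 N_sqr)|exact: (profile_root d N_ge0
  N_sqr)|].
move=> alpha _ ealpha c E' [dE' appE'].
have shift beta : hnorm (sqrt_expphi_op E' beta Omega) =
    hnorm (sqrt_expphi_op E (beta - c) Omega).
  have dEE' : odom (fcalc E' id) = odom (fcalc E id) by rewrite -dE' -dH.
  have e : expphi_mean ip_norm E' Omega beta =
    expphi_mean ip_norm E Omega (beta - c).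
    rewrite !expphi_meanE -(integral_spectral_shift (c := c) ip_norm _ dEE').
    - by apply: eq_integral => l _; congr (expphi _)%:E; ring.
    - by move=> chi dchi; rewrite -appE' ?dEE' //= appH.
    - exact: measurable_expphi_shift.
    - by move=> l; exact: ltW (expphi_gt0 _).
  have eq_of_sqr (x y : R) u : 0 <= x -> 0 <= y ->
      (x ^+ 2)%:E = u -> (y ^+ 2)%:E = u -> x = y.
    by move=> x0 y0 <- [/eqP]; rewrite eqrXn2 // => /eqP.
  apply: (eq_of_sqr _ _ _ (hnorm_ge0 _) (hnorm_ge0 _) _ (N_sqr (beta - c))).
  rewrite -e; apply: hnorm_sqrt_expphi.
  by rewrite e ltey_eq expphi_mean_fin.
split; first by rewrite shift addrK.
move=> beta; rewrite shift -ealpha => /(profile_inj d N_ge0 N_sqr Omega0) <-.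
by rewrite subrK.
Qed.
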